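(* Let $f:\mathcal{X}\to\mathbb{R}$ be a monotone, normalized function with DR-submodularity ratio $\beta$, and let $\mathcal{P}=conv(E)\subseteq\mathbb{R}^n_+$ with $E$ a finite nonempty set. Suppose that $|f(\bm{x})-f(\bm{y})|\le L\|\bm{x}-\bm{y}\|$ for all $\bm{x},\bm{y}\in Frontier(\mathcal{P})$, and that $\|\bm{x}\|\le D$ for all $\bm{x}\in\mathcal{P}$. Let $\mathrm{OPT}=\max_{\bm{x}\in\mathcal{P}}f(\bm{x})$, and let $l,\gamma$ be positive integers with $\gamma$ dividing $l$. Then under additive noise, generalized LDGM with $\rho_t=1$ for all $t$, with $l$ steps and look-ahead parameter $\gamma$, outputs a point $\bm{x}\in\mathcal{P}$ with $$f(\bm{x})\ \ge\ (1-e^{-\beta^2})\cdot\mathrm{OPT}-\frac{mDL(1-e^{-\beta^2})\gamma}{l}-\frac{\beta}{l}\sum_{t=0}^{l-1}\Big(1-\frac{\beta^2}{l}\Big)^{l-1-t}\sum_{j=1}^{l/\gamma}\big(\epsilon_{t,i^*_t}-\epsilon_{t,i_j}\big),$$ where $m=|\mathcal{E}|\le|E|$, $\epsilon_{t,i}$ is the noise of the function value at $\bm{x}_t+\gamma\bm{e}_i$, $i^*_t$ is the index of the vector of $\mathcal{E}$ selected in iteration $t$, and $i_1,\dots,i_{l/\gamma}$ are indices such that $\bm{v}^*_\gamma=\sum_{j=1}^{l/\gamma}\gamma\bm{e}_{i_j}$ maximizes $f$ among all sums of $l/\gamma$ (not necessarily distinct) vectors of $\gamma\cdot\mathcal{E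}=\{\gamma\bm{e}:\bm{e}\in\mathcal{E}\}$.
   Context: Notation: for vectors, $\bm{x}\le\bm{y}$ means $x_i\le y_i$ for all $i$, and $\bm{x}<\bm{y}$ means $\bm{x}\le\bm{y}$ and $x_i<y_i$ for some $i$. $\|\cdot\|$ is the Euclidean norm, $\bm{\chi}_i$ the $i$-th unit vector, $\mathbb{R}_+$ the non-negative reals, $[n]=\{1,\dots,n\}$. Functions: $\mathcal{X}=\prod_{i=1}^n\mathcal{X}_i$ with each $\mathcal{X}_i\subseteq\mathbb{R}_+$ compact. $f:\mathcal{X}\to\mathbb{R}$ is monotone if $\bm{x}\le\bm{y}$ implies $f(\bm{x})\le f(\bm{y})$, and normalized if $f(\bm{0})=0$. It is assumed that $\mathcal{X}$ contains every $\bm{z}$ with $\bm{0}\le\bm{z}\le\bm{p}+\bm{q}$ for some $\bm{p},\bm{q}\in\mathcal{P}$ (so that $f$ is defined where needed). DR-submodularity ratio: $$\beta=\inf_{\bm{x}\le\bm{y},\,k\in\mathbb{R}_+,\,i\in[n]}\frac{f(\bm{x}+k\bm{\chi}_i)-f(\bm{x})}{f(\bm{y}+k\bm{\chi}_i)-f(\bm{y})},$$ where all four points lie in $\mathcal{X}$ and choices with zero denominator are disregarded (with $\beta=1$ if no choice remains). Frontier: for a set $S\subseteq\mathbb{R}^n_+$, $Frontier(S)=\{\bm{x}\in S:\ \nexists\,\bm{y}\in S,\ \bm{y}>\bm{x}\}$. Generalized LDGM with $\rho_t=1$ (parameters $l,\gamma$) under additive noise: set $\mathcal{E}=\{\frac1l\bm{x}:\bm{x}\in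 Frontier(E)\}=\{\bm{e}_1,\dots,\bm{e}_m\}$ and $\bm{x}_0=\bm{0}$. For $t=0,\dots,l-1$: for each $i\in[m]$ a noisy value $\tilde f(\bm{x}_t+\gamma\bm{e}_i)=f(\bm{x}_t+\gamma\bm{e}_i)+\epsilon_{t,i}$ is observed, where the $\epsilon_{t,i}\in\mathbb{R}$ are arbitrary, together with one noisy value $\tilde f(\bm{x}_t)$ common to all $i$; choose $i^*_t\in\arg\max_{i\in[m]}\big(\tilde f(\bm{x}_t+\gamma\bm{e}_i)-\tilde f(\bm{x}_t)\big)$ (equivalently, maximizing $f(\bm{x}_t+\gamma\bm{e}_i)+\epsilon_{t,i}$), and set $\bm{x}_{t+1}=\bm{x}_t+\bm{e}_{i^*_t}$. Output $\bm{x}_l$. *)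

(* Defs.v *)
From mathcomp Require Import all_boot all_order all_algebra finmap.
From mathcomp Require Import boolp classical_sets functions reals.
From mathcomp Require Import topology normedtype exp sequences.

Set Implicit Arguments.
Unset Strict Implicit.
Unset Printing Implicit Defensive.

Import Order.TTheory GRing.Theory Num.Theory.
Import numFieldNormedType.Exports.

Local Open Scope classical_set_scope.
Local Open Scope ring_scope.

(* The norm `|x| of a row vector is the sup norm, hence a separate Euclidean
   norm. *)
Definition norm2 (R : realType) (n : nat) (x : 'rV[R]_n) : R :=
  Num.sqrt (\sum_(i < n) x 0 i ^+ 2).

Definition lev (R : realType) (n : nat) (x y : 'rV[R]_n) : Prop :=
  forall i, x 0 i <= y 0 i.

(* Strict in at least one coordinate, not necessarily in all of them. *)
Definition ltv (R : realType) (n : nat) (x y : 'rV[R]_n) : Prop :=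
  lev x y /\ exists i, x 0 i < y 0 i.

Definition unitv (R : realType) (n : nat) (i : 'I_n) : 'rV[R]_n :=
  delta_mx 0 i.

Definition prodset (R : realType) (n : nat) (Xi : 'I_n -> set R) :
    set 'rV[R]_n :=
  [set x | forall i, Xi i (x 0 i)].

Definition conv (R : realType) (n : nat) (E : {fset 'rV[R]_n}) :
    set 'rV[R]_n :=
  [set x | exists w : 'rV[R]_n -> R,
    [/\ forall v, v \in E -> 0 <= w v,
        \sum_(v <- E) w v = 1
      & x = \sum_(v <- E) w v *: v]].

Definition Frontier (R : realType) (n : nat) (S : set 'rV[R]_n) :
    set 'rV[R]_n :=
  [set x | S x /\ ~ exists y, S y /\ ltv x y].

(* Functions are total on 'rV[R]_n, but only their values on the domain X are
   ever constrained. *)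
Definition monotone_on (R : realType) (n : nat) (X : set 'rV[R]_n)
    (f : 'rV[R]_n -> R) : Prop :=
  forall x y, X x -> X y -> lev x y -> f x <= f y.

Definition DR_quotients (R : realType) (n : nat) (X : set 'rV[R]_n)
    (f : 'rV[R]_n -> R) : set R :=
  [set r | exists (x y : 'rV[R]_n) (k : R) (i : 'I_n),
    [/\ lev x y, 0 <= k,
        [/\ X x, X y, X (x + k *: unitv R i) & X (y + k *: unitv R i)],
        f (y + k *: unitv R i) - f y != 0
      & r = (f (x + k *: unitv R i) - f x) / (f (y + k *: unitv R i) - f y)]].

Definition DR_ratio (R : realType) (n : nat) (X : set 'rV[R]_n)
    (f : 'rV[R]_n -> R) : R :=
  if DR_quotients X f == set0 then 1 else inf (DR_quotients X f).

Definition scaled_frontier (R : realType) (n : nat) (E : {fset 'rV[R]_n})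
    (l : nat) : set 'rV[R]_n :=
  [set l%:R^-1 *: x | x in Frontier [set` E]].

Definition maximum_on (R : realType) (T : Type) (A : set T) (f : T -> R)
    (M : R) : Prop :=
  (f @` A) M /\ ubound (f @` A) M.

(* A run of the algorithm: x t is the t-th iterate, istar t the index selected
   in iteration t, eps t i the noise of the observation at x t + gamma *: e i,
   and eps0 t the noise of the single observation at x t, which is shared by all
   i. Only the values at t < l (and x l) matter. *)
Definition LDGM_run (R : realType) (n m : nat) (f : 'rV[R]_n -> R)
    (e : 'I_m -> 'rV[R]_n) (l gamma : nat)
    (eps : nat -> 'I_m -> R) (eps0 : nat -> R)
    (istar : nat -> 'I_m) (x : nat -> 'rV[R]_n) : Prop :=
  x 0%N = 0 /\
  forall t, (t < l)%N ->
    let gain i := (f (x t + gamma%:R *: e i) + eps t i) - (f (x t) + eps0 t) in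
    (forall i, gain i <= gain (istar t)) /\ x t.+1 = x t + e (istar t).

(* Main.v *)
(** DR-submodularity with ratio [beta], applied once along the look-ahead
    direction and once along the summands of [v* := \sum_j gamma *: e (idx j)],
    shows that each step closes a fraction [beta^2 / l] of the gap to [f v*] up to
    noise; since [(1 - beta^2 / l)^l <= exp (- beta^2)], this yields the bound
    with [f v*] in place of [OPT].

    To compare [f v*] with [OPT], a maximizer is first pushed up to a point [y] of
    the Pareto frontier of the polytope. The vertices carrying [y] lie on the
    frontier of [E], and so does every other convex combination of them on the
    frontier of the polytope. Hence rounding the weights of [y] to multiples of
    [gamma / l] without enlarging the support stays where [f] is Lipschitz, and
    moves [y] by at most [m * D * gamma / l]. *)

Require Import Defs.
From mathcomp Require Import all_boot all_order all_algebra finmap.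
From mathcomp Require Import boolp classical_sets functions reals.
From mathcomp Require Import topology normedtype exp sequences.
From mathcomp Require Import derive ring lra.

Set Implicit Arguments.
Unset Strict Implicit.
Unset Printing Implicit Defensive.

Import Order.TTheory GRing.Theory Num.Theory.
Import numFieldNormedType.Exports.

Local Open Scope classical_set_scope.
Local Open Scope ring_scope.

(** * Convex combinations and the Pareto frontier of a polytope *)

Lemma sum_fibers (T : eqType) (V : nmodType) (s : seq T) (I : finType)
    (p : I -> T) (F : I -> V) :
  uniq s -> (forall i, p i \in s) ->
  \sum_(v <- s) \sum_(i | p i == v) F i = \sum_i F i.
Proof.
move=> us ps; rewrite (exchange_big_dep xpredT) //=.
apply: eq_bigr => i _; rewrite big_mkcond (bigD1_seq (p i)) //= eqxx.
rewrite big1 ?addr0 //.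
by move=> v /negbTE; rewrite eq_sym => ->.
Qed.

Section ConvexHull.
Variables (R : realType) (n : nat).
Implicit Types (E : {fset 'rV[R]_n}) (x y z v : 'rV[R]_n).

Lemma sum_fibersZ E (I : finType) (mu : I -> R) (p : I -> 'rV[R]_n) :
  (forall i, p i \in E) ->
  \sum_(v <- E) (\sum_(i | p i == v) mu i) *: v = \sum_i mu i *: p i.
Proof.
move=> pE; rewrite -(sum_fibers _ (fset_uniq E) pE).
by apply: eq_bigr => v _; rewrite scaler_suml; apply: eq_bigr => i /eqP ->.
Qed.

(** Since [p] may repeat vertices, each vertex receives the total weight of its fibre. *)
Lemma conv_sum E (I : finType) (mu : I -> R) (p : I -> 'rV[R]_n) :
  (forall i, p i \in E) -> (forall i, 0 <= mu i) -> \sum_i mu i = 1 ->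
  conv E (\sum_i mu i *: p i).
Proof.
move=> pE mu0 mu1; exists (fun v => \sum_(i | p i == v) mu i); split.
- by move=> v _; apply: sumr_ge0.
- by rewrite (sum_fibers _ (fset_uniq E) pE).
- by rewrite sum_fibersZ.
Qed.

Lemma conv_mem E v : v \in E -> conv E v.
Proof.
move=> vE; have -> : v = \sum_(i < 1) (1 : R) *: v by rewrite big_ord1 scale1r.
by apply: conv_sum => //; rewrite big_ord1.
Qed.

Lemma lev_trans y x z : lev x y -> lev y z -> lev x z.
Proof. by move=> xy yz i; exact: le_trans (xy i) (yz i). Qed.

(** Supplies the step length of the perturbation in [Frontier_face]: the weights are finitely many,
    so the positive ones have a common positive lower bound. *)
Lemma positive_weights_lower_bound (s : seq 'rV[R]_n) (w : 'rV[R]_n -> R) :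
  exists2 d, 0 < d & forall v, v \in s -> 0 < w v -> d <= w v.
Proof.
elim: s => [|a s [d d0 dP]]; first by exists 1.
have [wa|wa] := ltP 0 (w a).
  exists (Num.min d (w a)); first by rewrite lt_min d0.
  move=> v; rewrite inE => /orP[/eqP ->|vs] v0; rewrite ge_min ?lexx ?orbT //.
  by rewrite dP.
exists d => // v; rewrite inE => /orP[/eqP ->|]; last exact: dP.
by rewrite ltNge wa.
Qed.

(* If some [z] in the hull dominated [u := \sum c v *: v], then
   [y + d *: (z - u)] would be in the hull for small [d] and dominate [y]. *)
Lemma Frontier_face E (w c : 'rV[R]_n -> R) :
  (forall v, v \in E -> 0 <= w v) -> \sum_(v <- E) w v = 1 ->
  (forall v, v \in E -> 0 <= c v) -> \sum_(v <- E) c v = 1 ->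
  (forall v, v \in E -> w v = 0 -> c v = 0) ->
  Frontier (conv E) (\sum_(v <- E) w v *: v) ->
  Frontier (conv E) (\sum_(v <- E) c v *: v).
Proof.
move=> w0 w1 c0 c1 wc [_ yF]; split; first by exists c.
case=> z [[a [a0 a1 ->]] [uz [i0 uz0]]]; apply: yF.
have [d d0 dP] := positive_weights_lower_bound (E : seq _) w.
exists (\sum_(v <- E) (w v - d * c v + d * a v) *: v).
have cle1 v : v \in E -> c v <= 1.
  move=> vE; rewrite -c1 (bigD1_seq v) ?fset_uniq //= lerDl big_seq_cond.
  by apply: sumr_ge0 => u /andP[uE _]; exact: c0.
have eqn i : (\sum_(v <- E) (w v - d * c v + d * a v) *: v) 0 i =
  (\sum_(v <- E) w v *: v) 0 i +
  d * ((\sum_(v <- E) a v *: v) 0 i - (\sum_(v <- E) c v *: v) 0 i).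
  rewrite !summxE -sumrB mulr_sumr -big_split /=; apply: eq_bigr => v _.
  by rewrite !mxE; ring.
split; last split.
- eexists; split; last reflexivity.
  + move=> v vE; apply: addr_ge0; last by rewrite mulr_ge0 ?a0 // ltW.
    (* Subtracting [d * c v] keeps the weight nonnegative: [d] is below every positive [w v] and
       [c v <= 1], while [c v] vanishes wherever [w v] does. *)
    have [wv|wv] := ltP 0 (w v).
      rewrite subr_ge0; apply: le_trans (dP v vE wv).
      by rewrite ger_pMr // cle1.
    have wv0 : w v = 0 by apply/eqP; rewrite eq_le wv w0.
    by rewrite (wc v vE wv0) wv0 mulr0 subr0.
  + by rewrite big_split sumrB /= -!mulr_sumr w1 c1 a1 subrK.
- by move=> i; rewrite eqn lerDl mulr_ge0 ?(ltW d0) // subr_ge0.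
- by exists i0; rewrite eqn ltrDl mulr_gt0 // subr_gt0.
Qed.

(** The point mass at [v] vanishes wherever [w] does, so [Frontier_face] puts [v] itself on the
    frontier of the hull, which contains [E]. *)
Lemma Frontier_support E (w : 'rV[R]_n -> R) v :
  (forall u, u \in E -> 0 <= w u) -> \sum_(u <- E) w u = 1 ->
  Frontier (conv E) (\sum_(u <- E) w u *: u) ->
  v \in E -> w v != 0 -> Frontier [set` E] v.
Proof.
move=> w0 w1 yF vE wv; split => // -[z [zE vz]].
have cE (V : lmodType R) (F : 'rV[R]_n -> V) :
    \sum_(u <- E) (u == v)%:R *: F u = F v.
  rewrite (bigD1_seq v) ?fset_uniq //= eqxx scale1r big1 ?addr0 //.
  by move=> u /negbTE ->; rewrite scale0r.
have c1 : \sum_(u <- E) (u == v)%:R = 1 :> R.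
  rewrite -[RHS](cE R^o (fun=> 1)).
  by apply: eq_bigr => u _; rewrite /GRing.scale /= mulr1.
have wc u : u \in E -> w u = 0 -> (u == v)%:R = 0 :> R.
  by move=> _ wu; case: eqP => // uv; rewrite -uv wu eqxx in wv.
have [_] := Frontier_face w0 w1 (fun u _ => ler0n _ (u == v)) c1 wc yF.
by apply; exists z; rewrite cE; split => //; exact: conv_mem.
Qed.

Lemma continuous_coord_sum k (c : 'I_k -> R) :
  continuous (fun w : 'rV[R]_k => \sum_j w 0 j * c j).
Proof.
apply: continuous_big => [|j _ w]; first exact: add_continuous.
apply: (@continuousM _ _ (fun w : 'rV[R]_k => w 0 j) (cst (c j))).
  exact: coord_continuous.
exact: cst_continuous.
Qed.

(* A point maximizing the sum of coordinates among those dominating [x]. *)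
Lemma Frontier_above E x : conv E x ->
  exists2 y, Frontier (conv E) y & lev x y.
Proof.
move=> [w [w0 w1 xE]].
pose k := size E; pose s (j : 'I_k) : 'rV[R]_n := E`_j.
have sE j : s j \in E by rewrite mem_nth.
have sumE (V : nmodType) (F : 'rV[R]_n -> V) :
    \sum_(v <- E) F v = \sum_j F (s j).
  by rewrite (big_nth 0) big_mkord.
pose comb (a : 'rV[R]_k) := \sum_j a 0 j *: s j.
have combE a i : comb a 0 i = \sum_j a 0 j * s j 0 i.
  by rewrite summxE; apply: eq_bigr => j _; rewrite mxE.
(* Compactness is taken in the space of weights: [K] is the closed part of the unit cube whose
   weights sum to 1 and whose combination dominates [x]. The factor 1 gives the total the shape of
   [continuous_coord_sum]. *)
pose K : set 'rV[R]_k := [set a | forall j, [set` `[0, 1]] (a 0 j)] `&`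
  ([set a | \sum_j a 0 j * 1 = 1] `&`
   \bigcap_(i in [set: 'I_n]) [set a | x 0 i <= \sum_j a 0 j * s j 0 i]).
have clK c (A : set R) : closed A ->
    closed [set a : 'rV[R]_k | A (\sum_j a 0 j * c j)].
  by have /continuous_closedP := @continuous_coord_sum k c; exact.
have cK : compact K.
  apply: compact_closedI.
    apply: (@rV_compact _ _ (fun=> [set` `[0 : R, 1]])) => i.
    exact: segment_compact.
  apply: closedI; first by apply: (clK (fun=> 1) [set r | r = 1]).
  apply: closed_bigI => i _; by apply: (clK _ [set r | x 0 i <= r]).
have rowE (b : 'rV[R]_n -> R) :
    comb (\row_j b (s j)) = \sum_(v <- E) b v *: v.
  by rewrite sumE; apply: eq_bigr => j _; rewrite mxE.
have rowK (b : 'rV[R]_n -> R) : (forall v, v \in E -> 0 <= b v) ->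
    \sum_(v <- E) b v = 1 -> lev x (\sum_(v <- E) b v *: v) ->
    K (\row_j b (s j)).
  move=> b0 b1 xb; split => [j|]; last split => [|i _] /=.
  - rewrite /= mxE in_itv /= b0 //= -b1 sumE (bigD1 j) //= lerDl.
    by apply: sumr_ge0 => i _; exact: b0.
  - by rewrite -[RHS]b1 sumE; apply: eq_bigr => j _; rewrite mxE mulr1.
  - by rewrite -combE rowE.
have K0 : K !=set0.
  by exists (\row_j w (s j)); apply: rowK => // i; rewrite xE.
have Kconv a : K a -> conv E (comb a).
  case=> a01 [/= a1 _]; apply: conv_sum => //.
    by move=> j; have := a01 j; rewrite /= in_itv /= => /andP[].
  by rewrite -[RHS]a1; apply: eq_bigr => j _; rewrite mulr1.
have [a aK amax] := compact_EVT_max K0 cK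
  (continuous_subspaceT (@continuous_coord_sum k (fun j => \sum_i s j 0 i))).
rewrite inE in aK.
have totE (b : 'rV[R]_k) : \sum_j b 0 j * (\sum_i s j 0 i) = \sum_i comb b 0 i.
  under [RHS]eq_bigr do rewrite combE.
  by rewrite exchange_big; apply: eq_bigr => j _; rewrite mulr_sumr.
have xa : lev x (comb a) by move=> i; rewrite combE; exact: aK.2.2.
exists (comb a) => //; split; first exact: Kconv.
case=> z [[b [b0 b1 zE]] [az [i0 az0]]].
have bK : K (\row_j b (s j)).
  by apply: rowK => //; rewrite -zE; exact: lev_trans xa az.
have := amax _ (mem_set bK); rewrite !totE rowE -zE leNgt => /negP; apply.
(* A dominating point has a strictly larger coordinate sum, against maximality. *)
rewrite (bigD1 i0) //= [ltRHS](bigD1 i0) //= ltr_leD //.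
by apply: ler_sum => i _; exact: az.
Qed.

End ConvexHull.

(** * Euclidean norm of linear combinations *)

Section Norm2.
Variables (R : realType) (n : nat).
Implicit Types (u v : 'rV[R]_n) (D : R).

Lemma norm2_ge0 u : 0 <= norm2 u.
Proof. exact: sqrtr_ge0. Qed.

Lemma norm2_sqr u : norm2 u ^+ 2 = \sum_c u 0 c ^+ 2.
Proof. by rewrite sqr_sqrtr // sumr_ge0 // => c _; exact: sqr_ge0. Qed.

(** Sums [2 * |a * b| <= a ^+ 2 + b ^+ 2] over the coordinates; with a common bound [D] this
    replaces Cauchy-Schwarz. *)
Lemma normr_dot_le u v D : norm2 u <= D -> norm2 v <= D ->
  `|\sum_c u 0 c * v 0 c| <= D ^+ 2.
Proof.
have sqD (w : 'rV[R]_n) : norm2 w <= D -> \sum_c w 0 c ^+ 2 <= D ^+ 2.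
  by move=> wD; rewrite -norm2_sqr lerXn2r // nnegrE ?(le_trans _ wD) ?norm2_ge0.
move=> /sqD uD /sqD vD; apply: le_trans (ler_norm_sum _ _ _) _.
apply: (@le_trans _ _ ((\sum_c u 0 c ^+ 2 + \sum_c v 0 c ^+ 2) / 2)); last lra.
rewrite -big_split mulr_suml /=; apply: ler_sum => c _.
rewrite ler_norml; apply/andP; split.
  by have := sqr_ge0 (u 0 c + v 0 c); lra.
by have := sqr_ge0 (u 0 c - v 0 c); lra.
Qed.

(** The squared norm expands into the products [a i * a j] times inner products, each at most
    [D ^+ 2] in absolute value. *)
Lemma norm2_sum_le (I : finType) (a : I -> R) (p : I -> 'rV[R]_n) D :
  0 <= D -> (forall i, norm2 (p i) <= D) ->
  norm2 (\sum_i a i *: p i) <= (\sum_i `|a i|) * D.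
Proof.
move=> D0 pD.
have A0 : 0 <= (\sum_i `|a i|) * D by rewrite mulr_ge0 ?sumr_ge0.
rewrite -(ger0_norm A0) -sqrtr_sqr ler_wsqrtr // exprMn.
have -> : \sum_c (\sum_i a i *: p i) 0 c ^+ 2 =
    \sum_i \sum_j a i * a j * \sum_c p i 0 c * p j 0 c.
  under eq_bigr => c _ do
    rewrite summxE expr2 mulr_suml; rewrite exchange_big; apply: eq_bigr => i _.
  under eq_bigr => c _ do rewrite mulr_sumr; rewrite exchange_big.
  apply: eq_bigr => j _; rewrite mulr_sumr; apply: eq_bigr => c _.
  by rewrite !mxE; ring.
rewrite expr2 mulr_suml mulr_suml; apply: ler_sum => i _.
rewrite mulr_sumr mulr_suml; apply: ler_sum => j _.
apply: le_trans (ler_norm _) _.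
by rewrite !normrM ler_wpM2l ?mulr_ge0 // normr_dot_le.
Qed.

End Norm2.

(** * Integer rounding of weights *)

(* Rounding the partial sums of [N * lam] rather than its entries makes the
   total exact; each entry moves by at most 1 and null entries stay null. *)
Lemma cumulative_rounding (R : realType) (m N : nat) (lam : 'I_m -> R) :
  (forall i, 0 <= lam i) -> \sum_i lam i = 1 ->
  exists k : 'I_m -> nat, [/\ (\sum_i k i)%N = N,
    forall i, lam i = 0 -> k i = 0%N &
    forall i, `|(k i)%:R - N%:R * lam i| <= 1].
Proof.
move=> lam0 lam1.
pose g (j : nat) : R := if insub j is Some i then lam i else 0.
have gE (i : 'I_m) : g i = lam i by rewrite /g valK.
have g0 j : 0 <= g j by rewrite /g; case: insubP.
pose S (j : nat) : R := N%:R * \sum_(0 <= i < j) g i.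
have SS j : S j.+1 = S j + N%:R * g j by rewrite /S big_nat_recr //= mulrDr.
have S0 j : 0 <= S j by rewrite mulr_ge0 ?sumr_ge0.
have Sle j : (Num.truncn (S j) <= Num.truncn (S j.+1))%N.
  by apply: le_truncn; rewrite SS lerDl mulr_ge0.
exists (fun i => Num.truncn (S i.+1) - Num.truncn (S i))%N; split.
- rewrite -(big_mkord xpredT (fun j => (Num.truncn (S j.+1) - Num.truncn (S j))%N)).
  rewrite telescope_sumn_in // [S 0%N]/S big_geq // mulr0 truncn0 subn0.
  by rewrite /S big_mkord (eq_bigr lam) // lam1 mulr1 natrK.
- by move=> i li; rewrite SS gE li mulr0 addr0 subnn.
(* The error is a difference of two fractional parts, each in [0, 1). *)
- move=> i; rewrite natrB // -gE.
  have /andP[a1 a2] := truncn_itv (S0 i); have /andP[b1 b2] := truncn_itv (S0 i.+1).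
  move: a2 b1 b2; rewrite SS -!natr1 ler_norml => a2 b1 b2.
  by apply/andP; split; lra.
Qed.

(** Turns multiplicities into a family of [N] indices, the form over which the optimal sum ranges,
    by listing [k i] copies of each [i]. *)
Lemma multiset_enum (m N : nat) (k : 'I_m -> nat) : (\sum_i k i)%N = N ->
  exists idx : 'I_N -> 'I_m, forall (V : nmodType) (F : 'I_m -> V),
    \sum_j F (idx j) = \sum_i F i *+ k i.
Proof.
move=> kN; pose s := flatten [seq nseq (k i) i | i <- enum 'I_m].
have sN : size s = N.
  rewrite size_flatten /shape -map_comp sumnE big_map big_enum /= -kN.
  by apply: eq_bigr => i _; rewrite size_nseq.
exists (tnth (Tuple (introT eqP sN))) => V F.
rewrite -(big_tuple _ _ (Tuple (introT eqP sN)) xpredT F) /= big_flatten big_map.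
rewrite big_enum /=; apply: eq_bigr => i _.
by rewrite big_nseq -Monoid.iteropE.
Qed.

(** * The DR-submodularity ratio along vectors and sums *)

Section DRSubmodularity.
Variables (R : realType) (n : nat) (X : set 'rV[R]_n) (f : 'rV[R]_n -> R).
Hypothesis fmono : monotone_on X f.
Implicit Types (x y d : 'rV[R]_n).

Lemma lev0_coord d j : lev 0 d -> 0 <= d 0 j.
Proof. by move=> /(_ j); rewrite [X in X <= _ -> _]mxE. Qed.

Lemma lev_addl x d : lev 0 d -> lev x (x + d).
Proof. by move=> d0 i; rewrite mxE lerDl lev0_coord. Qed.

Lemma levD x y x' y' : lev x y -> lev x' y' -> lev (x + x') (y + y').
Proof. by move=> xy xy' i; rewrite !mxE lerD. Qed.

Lemma lev0D x y : lev 0 x -> lev 0 y -> lev 0 (x + y).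
Proof. by move=> x0 y0; apply: lev_trans x0 _; exact: lev_addl. Qed.

Lemma lev0Z (a : R) x : 0 <= a -> lev 0 x -> lev 0 (a *: x).
Proof.
by move=> a0 x0 j; rewrite [X in X <= _]mxE mxE mulr_ge0 // lev0_coord.
Qed.

Lemma lev_unitv (k : R) i : 0 <= k -> lev 0 (k *: unitv R i : 'rV[R]_n).
Proof. by move=> k0 j; rewrite !mxE mulr_ge0. Qed.

Lemma DR_quotients_ge0 : lbound (DR_quotients X f) 0.
Proof.
move=> _ [x [y [k [i [xy k0 [Xx Xy Xxk Xyk] _ ->]]]]].
by apply: divr_ge0; rewrite subr_ge0 fmono //; apply/lev_addl/lev_unitv.
Qed.

Lemma DR_ratio_ge0 : 0 <= DR_ratio X f.
Proof.
rewrite /DR_ratio; case: ifP => // /negbT/set0P Q0.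
by apply: lb_le_inf => //; exact: DR_quotients_ge0.
Qed.

(** Taking both base points equal gives the quotient 1. *)
Lemma DR_ratio_le1 : DR_ratio X f <= 1.
Proof.
rewrite /DR_ratio; case: ifP => // /negbT/set0P[r [x [y [k [i]]]]].
case=> xy k0 [Xx Xy Xxk Xyk] ny _.
apply: ge_inf; first by exists 0; exact: DR_quotients_ge0.
by exists y, y, k, i; split => //; rewrite divff.
Qed.

(** The definition with denominators cleared; for a zero denominator the claim is monotonicity. *)
Lemma DR_ratio_unitv x y (k : R) i :
  lev x y -> 0 <= k -> X x -> X y -> X (x + k *: unitv R i) ->
  X (y + k *: unitv R i) ->
  DR_ratio X f * (f (y + k *: unitv R i) - f y) <= f (x + k *: unitv R i) - f x.
Proof.
move=> xy k0 Xx Xy Xxk Xyk.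
have fx : 0 <= f (x + k *: unitv R i) - f x.
  by rewrite subr_ge0 fmono //; apply/lev_addl/lev_unitv.
have fy : 0 <= f (y + k *: unitv R i) - f y.
  by rewrite subr_ge0 fmono //; apply/lev_addl/lev_unitv.
have [->|ny] := eqVneq (f (y + k *: unitv R i) - f y) 0; first by rewrite mulr0.
have q : DR_quotients X f
    ((f (x + k *: unitv R i) - f x) / (f (y + k *: unitv R i) - f y)).
  by exists x, y, k, i.
rewrite -ler_pdivlMr; last by rewrite lt_def ny.
rewrite /DR_ratio; case: ifP => [/eqP Q0|_]; first by rewrite Q0 in q.
by apply: ge_inf => //; exists 0; exact: DR_quotients_ge0.
Qed.

(** [X] may have gaps, so intermediate points are kept in a downward closed part [B] of it. *)
Variable B : set 'rV[R]_n.
Hypothesis BX : B `<=` X.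
Hypothesis Bdown : forall x y, lev 0 x -> lev x y -> B y -> B x.

(** Adds [d] one coordinate at a time through its truncations [tr k]; the one-coordinate
    inequalities telescope. *)
Lemma DR_ratio_vec x y d : lev 0 x -> lev x y -> lev 0 d -> B (y + d) ->
  DR_ratio X f * (f (y + d) - f y) <= f (x + d) - f x.
Proof.
move=> x0 xy d0 Byd.
pose tr (k : nat) : 'rV[R]_n := \row_j (if (j < k)%N then d 0 j else 0).
have d0' j : 0 <= d 0 j by exact: lev0_coord.
have tr0 k : lev 0 (tr k) by move=> j; rewrite !mxE; case: ifP.
have trd k : lev (tr k) d by move=> j; rewrite mxE; case: ifP.
have y0 := lev_trans x0 xy.
have Xy k : X (y + tr k).
  by apply/BX/(Bdown (lev0D y0 (tr0 k)) _ Byd); exact: levD.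
have Xx k : X (x + tr k).
  by apply/BX/(Bdown (lev0D x0 (tr0 k)) _ Byd); exact: levD.
have key k : (k <= n)%N ->
    DR_ratio X f * (f (y + tr k) - f y) <= f (x + tr k) - f x.
  elim: k => [|k IH] kn.
    have -> : tr 0%N = 0 by apply/rowP => j; rewrite !mxE.
    by rewrite !addr0 !subrr mulr0.
  have trS : tr k.+1 = tr k + d 0 (Ordinal kn) *: unitv R (Ordinal kn).
    apply/rowP => j; rewrite !mxE ltnS leq_eqVlt eqxx /= -val_eqE /=.
    case: eqP => [jk|_] /=; last by rewrite mulr0 addr0.
    rewrite jk ltnn add0r mulr1; congr (d 0 _); exact: val_inj.
  have xyk : lev (x + tr k) (y + tr k).
    by move=> j; have := xy j; rewrite !mxE lerD2r.
  have := DR_ratio_unitv xyk (d0' (Ordinal kn)) (Xx k) (Xy k).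
  move=> /(_ (Ordinal kn)).
  rewrite -!addrA -trS => /(_ (Xx _) (Xy _)); have := IH (ltnW kn).
  by rewrite !mulrBr; lra.
have trn : tr n = d by apply/rowP => j; rewrite mxE ltn_ord.
by have := key n (leqnn n); rewrite trn.
Qed.

Lemma lev_sum_ge0 N (d : 'I_N -> 'rV[R]_n) :
  (forall j, lev 0 (d j)) -> lev 0 (\sum_j d j).
Proof.
move=> d0 c; rewrite summxE mxE sumr_ge0 // => j _.
exact: lev0_coord.
Qed.

(** Telescopes over the summands: adding the last one on top of the partial sum [s] is compared with
    adding it directly to [x]. *)
Lemma DR_ratio_sum N x (d : 'I_N -> 'rV[R]_n) :
  lev 0 x -> (forall j, lev 0 (d j)) -> B (x + \sum_j d j) ->
  DR_ratio X f * (f (x + \sum_j d j) - f x) <= \sum_j (f (x + d j) - f x).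
Proof.
move=> x0; elim: N d => [|N IH] d d0.
  by rewrite !big_ord0 addr0 subrr mulr0.
rewrite !big_ord_recr /=; set s := \sum_(j < N) _ => Bs.
have s0 : lev 0 s by apply: lev_sum_ge0.
have Bxs : B (x + s).
  apply: Bdown Bs; first exact: lev0D.
  by rewrite addrA; exact: lev_addl.
have := IH _ (fun j => d0 (widen_ord (leqnSn N) j)) Bxs.
rewrite addrA in Bs.
have := DR_ratio_vec x0 (lev_addl x s0) (d0 ord_max) Bs.
rewrite addrA -/s !mulrBr; set S := \sum_(i < N) _; lra.
Qed.

End DRSubmodularity.

(** * The scalar recursion and its exponential estimate *)

(** Each step multiplies the gap [V - a t] by at most [1 - c], up to [b t], and later steps discount
    that error by the same factor. *)
Lemma linear_recursion_lower (R : realType) (c V : R) (a b : nat -> R) (l : nat) :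
  0 <= c <= 1 -> a 0%N = 0 ->
  (forall t, (t < l)%N -> a t + c * (V - a t) - b t <= a t.+1) ->
  (1 - (1 - c) ^+ l) * V - \sum_(t < l) (1 - c) ^+ (l - 1 - t) * b t <= a l.
Proof.
move=> /andP[c0 c1] a0; elim: l => [|l IH] step.
  by rewrite big_ord0 expr0 subrr mul0r subr0 a0.
have {}IH := IH (fun t tl => step t (ltnW tl)).
rewrite big_ord_recr /= subn1 /= subnn expr0 mul1r.
have -> : \sum_(t < l) (1 - c) ^+ (l - t) * b t =
    (1 - c) * \sum_(t < l) (1 - c) ^+ (l - 1 - t) * b t.
  rewrite mulr_sumr; apply: eq_bigr => t _; rewrite mulrA -exprS.
  by rewrite subnAC subn1 prednK // subn_gt0.
have := step l (ltnSn l); have := ler_wpM2l (_ : 0 <= 1 - c) IH.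
rewrite subr_ge0 => /(_ c1); rewrite exprS.
set s := \sum_(t < l) _; set p := (1 - c) ^+ l; lra.
Qed.

(** The [l]-th power of [1 + z <= expR z] at [z = - (c / l)], whose left side is nonnegative because
    [c <= 1 <= l]. *)
Lemma expr_1sub_le_expR (R : realType) (c : R) (l : nat) :
  (0 < l)%N -> 0 <= c <= 1 -> (1 - c / l%:R) ^+ l <= expR (- c).
Proof.
move=> l0 /andP[c0 c1]; have l0R : 0 < l%:R :> R by rewrite ltr0n.
have -> : expR (- c) = expR (- (c / l%:R)) ^+ l.
  by rewrite -expRM_natr mulNr divfK // gt_eqF.
apply: lerXn2r; rewrite ?nnegrE ?expR_ge0 ?expR_ge1Dx // subr_ge0.
by rewrite ler_pdivrMr // mul1r (le_trans c1) // ler1n.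
Qed.

(** * Rounding a frontier point within its face *)

(** Null weights stay null, so [Frontier_face] applies to the rounded point; each of the [m] weights
    moves by at most [1 / N] and multiplies a vector of norm at most [D]. *)
Lemma Frontier_rounding (R : realType) (n m N : nat) (E : {fset 'rV[R]_n})
    (p : 'I_m -> 'rV[R]_n) (y : 'rV[R]_n) (D : R) :
  injective p -> (forall v, Frontier [set` E] v <-> exists i, p i = v) ->
  (0 < N)%N -> 0 <= D -> (forall i, norm2 (p i) <= D) ->
  Frontier (conv E) y ->
  exists idx : 'I_N -> 'I_m,
    let u := \sum_j N%:R^-1 *: p (idx j) in
    Frontier (conv E) u /\ norm2 (y - u) <= m%:R * D / N%:R.
Proof.
move=> pinj pF N0 D0 pD yF; have [[w [w0 w1 yE]] _] := yF.
have pE i : p i \in E by have /pF[] : exists j, p j = p i by exists i.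
have N0R : N%:R != 0 :> R by rewrite pnatr_eq0 -lt0n.
(* Vertices off the frontier carry no weight in [y], by [Frontier_support], so sums over [E] reduce
   to the enumeration [p]. *)
have sumE (V : nmodType) (G : 'rV[R]_n -> V) :
    (forall v, v \in E -> w v = 0 -> G v = 0) ->
    \sum_(v <- E) G v = \sum_i G (p i).
  move=> G0; rewrite -(sum_fibers _ (fset_uniq E) pE) !big_seq.
  apply: eq_bigr => v vE; rewrite (eq_bigr (fun=> G v)); last by move=> i /eqP ->.
  have [wv|wv] := eqVneq (w v) 0; first by rewrite G0 // big1.
  have /pF[i piv] : Frontier [set` E] v.
    by rewrite yE in yF; exact: Frontier_support yF vE wv.
  rewrite (big_pred1 i) // => j /=; rewrite -piv; apply/eqP/eqP => [|-> //].
  exact: pinj.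
have yp : y = \sum_i w (p i) *: p i.
  by rewrite yE sumE // => v _ ->; rewrite scale0r.
have [||k [kN k0 k1]] := @cumulative_rounding R m N (fun i => w (p i)).
- by move=> i; exact: w0.
- by rewrite -w1 sumE.
have [idx idxE] := multiset_enum kN.
exists idx; rewrite /= (idxE _ (fun i => N%:R^-1 *: p i)).
have uE : \sum_i N%:R^-1 *: p i *+ k i = \sum_i ((k i)%:R / N%:R) *: p i.
  by apply: eq_bigr => i _; rewrite -scaler_nat scalerA.
rewrite uE; split.
- rewrite -(sum_fibersZ _ pE).
  rewrite yE in yF; apply: Frontier_face w0 w1 _ _ _ yF.
  + by move=> v _; apply: sumr_ge0 => i _; rewrite divr_ge0.
  + rewrite (sum_fibers _ (fset_uniq E) pE) -mulr_suml -natr_sum kN divff //.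
  + by move=> v _ wv; apply: big1 => i /eqP piv; rewrite k0 ?mul0r // piv.
- rewrite yp -sumrB; under eq_bigr do rewrite -scalerBl.
  apply: le_trans (norm2_sum_le _ D0 pD) _.
  rewrite mulrAC ler_wpM2r // -[m in leRHS]card_ord -sum1_card natr_sum mulr_suml.
  apply: ler_sum => i _; rewrite mul1r -[leRHS]ger0_norm ?invr_ge0 //.
  have -> : w (p i) - (k i)%:R / N%:R = - ((k i)%:R - N%:R * w (p i)) / N%:R.
    by field.
  by rewrite normrM normrN ler_piMl.
Qed.

(** * The approximation guarantee for a run of the algorithm *)

Theorem theorem4 (R : realType) (n : nat)
  (* the domain of f and the feasible polytope conv E *)
  (Xi : 'I_n -> set R)
  (hXi_compact : forall i, compact (Xi i))
  (hXi_ge0 : forall i r, Xi i r -> 0 <= r)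
  (E : {fset 'rV[R]_n}) (hE : E != fset0)
  (hP_ge0 : forall p, conv E p -> lev 0 p)
  (hX : forall p q z, conv E p -> conv E q ->
     lev 0 z -> lev z (p + q) -> prodset Xi z)
  (* the objective *)
  (f : 'rV[R]_n -> R)
  (hf_mono : monotone_on (prodset Xi) f)
  (hf_norm : f 0 = 0)
  (beta : R) (hbeta : beta = DR_ratio (prodset Xi) f)
  (L : R) (hL0 : 0 <= L)
  (hL : forall x y, Frontier (conv E) x -> Frontier (conv E) y ->
     `|f x - f y| <= L * norm2 (x - y))
  (D : R) (hD : forall x, conv E x -> norm2 x <= D)
  (OPT : R) (hOPT : maximum_on (conv E) f OPT)
  (* the parameters and a run of the algorithm *)
  (l gamma : nat) (hl : (0 < l)%N) (hgamma : (0 < gamma)%N)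
  (hdvd : (gamma %| l)%N)
  (m : nat) (e : 'I_m -> 'rV[R]_n)
  (he : set_bij [set: 'I_m] (scaled_frontier E l) e)
  (eps : nat -> 'I_m -> R) (eps0 : nat -> R)
  (istar : nat -> 'I_m) (x : nat -> 'rV[R]_n)
  (hrun : LDGM_run f e l gamma eps eps0 istar x)
  (* the optimal sum of l / gamma vectors of gamma * e *)
  (idx : 'I_(l %/ gamma) -> 'I_m)
  (hidx : forall idx' : 'I_(l %/ gamma) -> 'I_m,
     f (\sum_(j < l %/ gamma) gamma%:R *: e (idx' j))
       <= f (\sum_(j < l %/ gamma) gamma%:R *: e (idx j))) :
  [/\ (m <= #|` E|)%N,
      conv E (x l)
    & f (x l) >=
        (1 - expR (- (beta ^+ 2))) * OPT
        - (m%:R * D * L * (1 - expR (- (beta ^+ 2))) * gamma%:R) / l%:R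
        - (beta / l%:R) *
          \sum_(t < l) (1 - beta ^+ 2 / l%:R) ^+ (l - 1 - t) *
            \sum_(j < l %/ gamma) (eps t (istar t) - eps t (idx j))].
Proof.
have l0R : l%:R != 0 :> R by rewrite pnatr_eq0 -lt0n.
have linv0 : 0 <= l%:R^-1 :> R by rewrite invr_ge0.
pose p i := l%:R *: e i.
have ep i : e i = l%:R^-1 *: p i by rewrite scalerA mulVf // scale1r.
case: he => efun einj esurj.
have pinj : injective p.
  by move=> i j /(scalerI l0R) ij; apply: einj; rewrite ?in_setT.
have pF v : Frontier [set` E] v <-> exists i, p i = v.
  split=> [vF|[i <-]].
    have [|i _ ei] := esurj (l%:R^-1 *: v); first by exists v.
    by exists i; rewrite /p ei scalerA divff // scale1r.
  have [u uF ue] := efun i I.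
  by rewrite /p -ue scalerA divff // scale1r.
have pE i : p i \in E by have /pF[] : exists j, p j = p i by exists i.
have pconv i : conv E (p i) := conv_mem (pE i).
have p0 i : lev 0 (p i) := hP_ge0 _ (pconv i).
have e0 i : lev 0 (e i) by rewrite ep; exact: lev0Z.
set N := (l %/ gamma)%N in idx hidx *.
have lE : l = (N * gamma)%N by rewrite divnK.
have N0 : (0 < N)%N by rewrite divn_gt0 // dvdn_leq.
have N0R : N%:R != 0 :> R by rewrite pnatr_eq0 -lt0n.
have g0R : gamma%:R != 0 :> R by rewrite pnatr_eq0 -lt0n.
(* Hence a sum of [N] look-ahead vectors is a convex combination with weights [1 / N]. *)
have geE i : gamma%:R *: e i = N%:R^-1 *: p i.
  by rewrite ep scalerA lE natrM; congr (_ *: _); field; rewrite N0R.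
have ge0 i : lev 0 (gamma%:R *: e i) by exact: lev0Z.
have gep i : lev (gamma%:R *: e i) (p i).
  move=> c; rewrite geE mxE ler_piMl ?lev0_coord // invf_le1 ?ltr0n //.
  by rewrite ler1n.
(* the Minkowski sum P + P, closed downwards, is where f is controlled *)
pose B : set 'rV[R]_n :=
  [set z | lev 0 z /\ exists q r, [/\ conv E q, conv E r & lev z (q + r)]].
have BX : B `<=` prodset Xi.
  by move=> z [z0 [q [r [qP rP zqr]]]]; exact: hX qP rP z0 zqr.
have Bdown z z' : lev 0 z -> lev z z' -> B z' -> B z.
  move=> z0 zz' [_ [q [r [qP rP z'qr]]]]; split=> //.
  by exists q, r; split=> //; exact: lev_trans z'qr.
have BD q r : conv E q -> conv E r -> B (q + r).
  move=> qP rP; split; first exact: lev0D (hP_ge0 _ qP) (hP_ge0 _ rP).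
  by exists q, r; split.
have PX q : conv E q -> prodset Xi q.
  move=> qP; apply/BX; apply: Bdown (BD _ _ qP qP); first exact: hP_ge0.
  exact/lev_addl/hP_ge0.
have v_conv (k : 'I_N -> 'I_m) : conv E (\sum_j gamma%:R *: e (k j)).
  under eq_bigr do rewrite geE.
  apply: (conv_sum (fun j => pE (k j))) => [j|]; first by rewrite invr_ge0.
  by rewrite sumr_const card_ord -[LHS]mulr_natl divff.
have [x0 xS] := hrun.
have xsum t : (t <= l)%N -> x t = \sum_(s < t) e (istar s).
  elim: t => [|t IH] tl; first by rewrite big_ord0.
  by rewrite big_ord_recr /= -IH ?(ltnW tl) // (xS t tl).2.
have xl_conv : conv E (x l).
  rewrite xsum //; under eq_bigr do rewrite ep.
  apply: (conv_sum (fun s : 'I_l => pE (istar s))) => //.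
  by rewrite sumr_const card_ord -[LHS]mulr_natl divff.
have xt0 t : (t <= l)%N -> lev 0 (x t).
  by move=> tl; rewrite xsum //; apply: lev_sum_ge0 => s.
have xtS t : (t < l)%N -> lev (x t) (x t.+1).
  by move=> tl; rewrite (xS t tl).2; exact: lev_addl.
have xtl t : (t <= l)%N -> lev (x t) (x l).
  move=> tl; rewrite -(subnKC tl).
  suff: forall d, (t + d <= l)%N -> lev (x t) (x (t + d)%N).
    by apply; rewrite subnKC.
  elim=> [|d IH] dl; first by rewrite addn0 => i.
  by rewrite addnS in dl *; exact: lev_trans (IH (ltnW dl)) (xtS _ dl).
(* [x t] lies below [x l], a point of the polytope, so [x t + q] lies below [x l + r]. *)
have Bx t q r : (t <= l)%N -> conv E r -> lev 0 q -> lev q r -> B (x t + q).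
  move=> tl rP q0 qr; apply: Bdown (BD _ _ xl_conv rP).
    exact: lev0D (xt0 t tl) q0.
  exact: levD (xtl t tl) qr.
have BxX t : (t <= l)%N -> prodset Xi (x t).
  move=> tl; apply: BX; rewrite -[x t]addr0.
  by apply: (Bx _ _ _ tl xl_conv) => //; exact: hP_ge0.
have beta0 : 0 <= beta by rewrite hbeta; exact: DR_ratio_ge0.
have beta1 : beta <= 1 by rewrite hbeta; exact: DR_ratio_le1.
have bb : 0 <= beta ^+ 2 <= 1 by rewrite sqr_ge0 expr_le1.
set v := \sum_j gamma%:R *: e (idx j) in hidx *.
have vP : conv E v := v_conv idx.
have v0 := hP_ge0 _ vP.
have X0 : prodset Xi 0 by rewrite -x0; exact: BxX.
have V0 : 0 <= f v by rewrite -hf_norm; apply: hf_mono => //; exact: PX.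
pose noise t := \sum_j (eps t (istar t) - eps t (idx j)).
have step t : (t < l)%N ->
    f (x t) + beta ^+ 2 / l%:R * (f v - f (x t)) - beta / l%:R * noise t
    <= f (x t.+1).
  move=> tl; have tl' := ltnW tl; have [hmax ->] := xS t tl.
  set i := istar t in hmax *; set G := f (x t + gamma%:R *: e i) - f (x t).
  (* The look-ahead vector is a sum of [gamma] copies of the actual step [e i]. *)
  have dr_look : beta * G <= gamma%:R * (f (x t + e i) - f (x t)).
    have gam (V : nmodType) (a : V) : \sum_(j < gamma) a = a *+ gamma.
      by rewrite sumr_const card_ord.
    rewrite /G scaler_nat mulr_natl -!gam hbeta.
    apply: (DR_ratio_sum hf_mono BX Bdown (d := fun=> e i)) => //.
      exact: xt0.
    by rewrite gam -scaler_nat; apply: (Bx _ _ _ tl' (pconv i)).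
  have dr_opt : beta * (f (x t + v) - f (x t)) <=
      \sum_j (f (x t + gamma%:R *: e (idx j)) - f (x t)).
    rewrite hbeta.
    apply: (DR_ratio_sum hf_mono BX Bdown
              (d := fun j => gamma%:R *: e (idx j))) => //.
      exact: xt0.
    by apply: (Bx _ _ _ tl' vP).
  (* The choice of [i] is tested against every [idx j]; the shared noise [eps0 t] cancels. *)
  have gains : \sum_j (f (x t + gamma%:R *: e (idx j)) - f (x t)) <=
      N%:R * G + noise t.
    rewrite -[N in N%:R * G]card_ord -sum1_card natr_sum mulr_suml -big_split /=.
    by apply: ler_sum => j _; have := hmax (idx j); rewrite /G /=; lra.
  have mono_v : f v <= f (x t + v).
    apply: hf_mono; first exact: PX.
      by apply/BX; apply: (Bx _ _ _ tl' vP).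
    by rewrite addrC; exact/lev_addl/xt0.
  have lR : 0 < l%:R :> R by rewrite ltr0n.
  (* With [l = N * gamma], the factor [gamma] comes from [dr_look] and [N] from [gains]; each use of
     the ratio contributes one [beta]. *)
  have ineq : beta * (beta * (f v - f (x t)) - noise t)
      <= l%:R * (f (x t + e i) - f (x t)).
    rewrite lE natrM -mulrA.
    apply: le_trans (_ : N%:R * (beta * G) <= _); last by rewrite ler_wpM2l.
    rewrite mulrCA ler_wpM2l // lerBlDr; apply: le_trans gains.
    by apply: le_trans dr_opt; rewrite ler_wpM2l // lerB.
  rewrite -(ler_pM2l lR).
  have -> : l%:R * (f (x t) + beta ^+ 2 / l%:R * (f v - f (x t)) -
      beta / l%:R * noise t) =
      l%:R * f (x t) + beta * (beta * (f v - f (x t)) - noise t) by field.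
  by move: ineq; rewrite [l%:R * (_ - _)]mulrBr; lra.
have fl : (1 - (1 - beta ^+ 2 / l%:R) ^+ l) * f v -
    beta / l%:R * \sum_(t < l) (1 - beta ^+ 2 / l%:R) ^+ (l - 1 - t) * noise t
    <= f (x l).
  rewrite mulr_sumr; under eq_bigr do rewrite mulrCA.
  apply: (linear_recursion_lower (a := f \o x)) step; last by rewrite /= x0.
  have /andP[b0 b1] := bb; rewrite divr_ge0 //=.
  by rewrite ler_pdivrMr ?ltr0n // mul1r (le_trans b1) // ler1n.
have near_opt : OPT - m%:R * D * L * gamma%:R / l%:R <= f v.
  have [[q qP qO] Oub] := hOPT.
  have [y yF qy] := Frontier_above qP.
  have D0 : 0 <= D by exact: le_trans (norm2_ge0 _) (hD _ vP).
  have [idx' [uF yu]] :=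
    Frontier_rounding pinj pF N0 D0 (fun i => hD _ (pconv i)) yF.
  (* The rounded point [u] is a candidate sum, so [f u <= f v]. *)
  have := hidx idx'; under eq_bigr do rewrite geE.
  set u := \sum_j _ in uF yu * => uv.
  have Oy : OPT <= f y.
    by rewrite -qO; apply: hf_mono => //; apply: PX => //; exact: yF.1.
  have yuL : f y - f u <= L * (m%:R * D / N%:R).
    apply: le_trans (ler_norm _) _; apply: le_trans (hL _ _ yF uF) _.
    by rewrite ler_wpM2l.
  have -> : m%:R * D * L * gamma%:R / l%:R = L * (m%:R * D / N%:R).
    by rewrite lE natrM; field; rewrite N0R.
  lra.
split.
- rewrite -[m]size_enum_ord -(size_map p); apply: uniq_leq_size.
    by rewrite map_inj_uniq // enum_uniq.
  by move=> _ /mapP[i _ ->].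
- exact: xl_conv.
- apply: le_trans fl; rewrite lerD2r.
  have exp1 : 0 <= 1 - expR (- beta ^+ 2).
    by rewrite subr_ge0 -expR0 ler_expR oppr_le0 sqr_ge0.
  (* First [near_opt] scaled by a nonnegative factor, then the exponential estimate scaled by [f v],
     which is nonnegative. *)
  apply: le_trans (_ : (1 - expR (- beta ^+ 2)) * f v <= _).
    have := ler_wpM2l exp1 near_opt; rewrite mulrBr.
    by congr (_ - _ <= _); ring.
  by rewrite ler_wpM2r // lerB // expr_1sub_le_expR.
Qed.
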